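(* Assume that both of the following hypotheses hold. (Conjecture 1) For every real number $\varepsilon$ with $0<\varepsilon<\frac12$ there is a positive constant $C_1$, depending on $\varepsilon$, such that $p(k)<k^{2-\varepsilon}$ for every positive integer $k>C_1$. (Conjecture 2) For every integer $n>6$, writing $p_1,\dots,p_k$ for all the odd primes smaller than $n$ (so $k=\pi(n-1)-1$), there exists an index $r$ with $1\le r\le k$ such that $\gcd(p_r,n)=1$ and $2n-p_r$ is coprime to $2n-p_i$ for every $i\in\{1,\dots,k\}$ with $i\neq r$. Then every sufficiently large even integer can be written as the sum of two distinct primes.
   Context: For positive integers $k,l$ with $\gcd(k,l)=1$ and $1\le l\le k-1$, $p(k,l)$ denotes the least prime $p$ with $p\equiv l \pmod k$. For an integer $k\geq 2$, $p(k)$ denotes the maximum of $p(k,l)$ over all $l$ with $\gcd(k,l)=1$ and $1\le l\le k-1$. $\pi(x)$ denotes the number of primes less than or equal to $x$. *)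

(* Defs.v *)
From HB Require Import structures.
From mathcomp Require Import all_boot all_order all_algebra.
From mathcomp Require Import all_classical all_reals all_analysis.

Set Implicit Arguments.
Unset Strict Implicit.
Unset Printing Implicit Defensive.

Import Order.TTheory GRing.Theory Num.Theory.

Local Open Scope ring_scope.

Definition prime_in_class (k l : nat) : pred nat :=
  fun p => prime p && (p == l %[mod k])%N.

(* p(k,l), as an extended real so that it is a total function: the least
   element of an empty set is +oo by convention. By Dirichlet's theorem this
   case does not occur when k and l are coprime and k > 0. *)
Definition least_prime (R : realType) (k l : nat) : \bar R :=
  if pselect (exists p, prime_in_class k l p) is left ex
  then (ex_minn ex)%:R%:E else +oo%E.

(* p(k); for k >= 2 the index l = 1 always occurs, so the neutral element -oo
   is never the value. *)
Definition max_least_prime (R : realType) (k : nat) : \bar R :=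
  \big[maxe/-oo%E]_(1 <= l < k | coprime k l) least_prime R k l.

Definition odd_primes_below (n : nat) : seq nat :=
  [seq p <- iota 0 n | prime p && odd p].

(* Main.v *)
Require Import Defs.
From HB Require Import structures.
From mathcomp Require Import all_boot all_order all_algebra.
From mathcomp Require Import all_classical all_reals all_analysis.

Set Implicit Arguments.
Unset Strict Implicit.
Unset Printing Implicit Defensive.

Import Order.TTheory GRing.Theory Num.Theory.

Local Open Scope ring_scope.

(** Let m = 2n be large. The second hypothesis supplies an odd prime P < n,
    coprime to n, such that 2n - P is coprime to 2n - p for every other odd
    prime p < n; the claim is that 2n - P, which exceeds n > P, is itself prime.

    If it is not, its least prime factor q satisfies q ^ 2 <= 2n. Moreover q is
    coprime to 2n: it is odd since 2n - P is, and a common factor of n and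
    2n - P would divide P. It therefore suffices to find an odd prime p < n,
    different from P, with p = 2n modulo q: then q divides both 2n - p and
    2n - P, against coprimality ([prime_double_subn]).

    Such a p is a prime in a residue class modulo 4 q ^ a. The factor 4 leaves
    room to ask for p = P + 2 modulo 4, which makes p odd and different from P
    ([prime_in_avoiding_class]). The first hypothesis, used with epsilon = 1/4
    and freed of real numbers in [small_prime_in_class], bounds p by k ^ (7/4),
    where k = 4 q ^ a, as soon as k exceeds a constant C. If q > C then a = 1
    will do, and k ^ 2 <= 32 n. If q <= C then a = C will do, and k is bounded
    by a constant. In both cases k ^ 2 <= c n with c depending only on C
    ([modulus_size]), so p ^ 8 < k ^ 14 <= c ^ 7 n ^ 7 <= n ^ 8 for
    n >= c ^ 7. *)

(** * Primes of size k ^ (7/4) in residue classes modulo k *)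

(** The maximum of p(k,l) dominates the entry at l reduced modulo k. Its
    finiteness provides the prime, and fourth powers clear the exponent
    2 - 1/4 = 7/4. *)
Lemma small_prime_in_class (R : realType)
  (conj1 : forall eps : R, 0 < eps -> eps < 1 / 2 ->
     exists C1 : R, 0 < C1 /\
       forall k : nat, (1 < k)%N -> C1 < k%:R ->
         (max_least_prime R k < (k%:R `^ (2 - eps))%:E)%E) :
  exists C : nat, forall k l : nat, (1 < k)%N -> (C < k)%N -> coprime k l ->
    exists p : nat, [/\ prime p, p = l %[mod k] & p ^ 4 < k ^ 7]%N.
Proof.
have e4_gt0 : 0 < 4^-1 :> R by rewrite invr_gt0.
have e4_lt : 4^-1 < 1 / 2 :> R by rewrite div1r ltf_pV2 ?posrE // ltr_nat.
have [C1 [C1_gt0 hC1]] := conj1 _ e4_gt0 e4_lt.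
exists (Num.bound C1) => k l k_gt1 Ck co_kl.
have C1k : C1 < k%:R.
  by rewrite (lt_trans (archi_boundP (ltW C1_gt0))) // ltr_nat.
have lk_in : (l %% k)%N \in index_iota 1 k.
  rewrite mem_index_iota ltn_pmod ?(ltnW k_gt1) // andbT lt0n.
  apply/eqP => lk0; move: co_kl; rewrite -coprime_modr lk0 /coprime gcdn0.
  by move/eqP=> k1; rewrite k1 in k_gt1.
have co_klk : coprime k (l %% k) by rewrite coprime_modr.
have : (least_prime R k (l %% k) < (k%:R `^ (2 - 4^-1))%:E)%E.
  apply: le_lt_trans (hC1 k k_gt1 C1k).
  exact: (@le_bigmax_seq _ _ _ _ -oo%E _ (fun j => coprime k j)
            (fun j => least_prime R k j)).
rewrite /least_prime; case: pselect => // ex.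
case: ex_minnP => p /andP[p_prime /eqP p_mod] _; rewrite lte_fin => p_lt.
exists p; split=> //; first by rewrite p_mod modn_mod.
rewrite -(ltr_nat R) !natrX.
have -> : k%:R ^+ 7 = (k%:R `^ (2 - 4^-1)) ^+ 4 :> R.
  rewrite -!powR_mulrn ?powR_ge0 // -powRrM; congr (_ `^ _).
  by rewrite mulrBl mulVf // -[2 * 4]natrM -[1]/(1%:R) -natrB.
by rewrite ltr_pXn2r // ?nnegrE ?powR_ge0.
Qed.

(** * A prime congruent to 2n and different from P *)

Local Open Scope nat_scope.

(** The least prime of a class might be 2 or P itself; prescribing the class of
    P + 2 modulo 4 excludes both at the cost of a constant factor in the
    modulus. *)
Lemma prime_in_avoiding_class (C : nat)
  (hC : forall k l : nat, 1 < k -> C < k -> coprime k l ->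
     exists p : nat, [/\ prime p, p = l %[mod k] & p ^ 4 < k ^ 7])
  (P t m : nat) :
  odd P -> odd m -> coprime m t -> C < 4 * m ->
  exists p : nat, [/\ prime p, odd p, p <> P, p = t %[mod m] &
                      p ^ 4 < (4 * m) ^ 7].
Proof.
move=> oddP odd_m co_mt Cm.
have co4 x : coprime 4 x = odd x by rewrite -[4]/(2 ^ 2) coprime_pexpl // coprime2n.
have co4m : coprime 4 m by rewrite co4.
pose l := chinese 4 m (P + 2) t.
have l4 : l = P + 2 %[mod 4] by exact: chinese_modl.
have lm : l = t %[mod m] by exact: chinese_modr.
have co_l : coprime (4 * m) l.
  rewrite coprimeMl -coprime_modr l4 coprime_modr co4 oddD oddP /=.
  by rewrite -coprime_modr lm coprime_modr.
have k_gt1 : 1 < 4 * m by rewrite (leq_trans (n := 4)) // leq_pmulr // odd_gt0.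
have [p [p_prime p_l p_lt]] := hC _ _ k_gt1 Cm co_l.
have p4 : p = P + 2 %[mod 4].
  by rewrite -l4 -(modn_dvdm p (dvdn_mulr m (dvdnn 4))) p_l modn_dvdm ?dvdn_mulr.
exists p; split=> //.
- by rewrite -co4 -coprime_modr p4 coprime_modr co4 oddD oddP.
- by move=> pP; move/eqP: p4; rewrite pP -{1}[P]addn0 eqn_modDl.
- by rewrite -lm -(modn_dvdm p (dvdn_mull 4 (dvdnn m))) p_l modn_dvdm ?dvdn_mull.
Qed.

(** For q > C the modulus 4 q already exceeds C; the finitely many q <= C are
    raised to the power C, which brings the modulus above C while keeping it
    bounded. *)
Lemma modulus_size (C q n : nat) :
  1 < q -> 0 < n -> q ^ 2 <= 2 * n ->
  exists a : nat, [/\ 0 < a, C < 4 * q ^ a &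
    (4 * q ^ a) ^ 2 <= (32 + (4 * C ^ C) ^ 2) * n].
Proof.
move=> q_gt1 n_gt0 q2; have [qC|Cq] := leqP q C.
  exists C; split; first exact: leq_trans (ltnW q_gt1) qC.
    by rewrite (leq_trans (ltn_expl C q_gt1)) // leq_pmull.
  rewrite (leq_trans (n := (4 * C ^ C) ^ 2)) //.
    by rewrite leq_exp2r // leq_mul2l leq_exp2r ?qC // (leq_trans (ltnW q_gt1)).
  by rewrite -[leqLHS]muln1 leq_mul // leq_addl.
exists 1; split=> //; first by rewrite expn1 (leq_trans Cq) // leq_pmull.
rewrite expn1 expnMn mulnDl -[32]/(4 ^ 2 * 2) -mulnA.
by rewrite (leq_trans _ (leq_addr _ _)) // leq_mul2l q2 orbT.
Qed.

(** The exponent 7/4 < 2 wins over the constant c: raising everything to the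
    eighth power gives p ^ 8 < k ^ 14 <= c ^ 7 n ^ 7 <= n ^ 8. *)
Lemma ltn_of_powers (p k c n : nat) :
  p ^ 4 < k ^ 7 -> k ^ 2 <= c * n -> c ^ 7 <= n -> p < n.
Proof.
move=> pk kc cn.
rewrite -(ltn_exp2r _ _ (isT : 0 < 4 * 2)) expnM.
have /leq_trans -> // : (p ^ 4) ^ 2 < (k ^ 7) ^ 2 by rewrite ltn_exp2r.
rewrite -expnM mulnC expnM -[4 * 2]/(7.+1) (expnS n).
by rewrite (leq_trans (n := (c * n) ^ 7)) ?leq_exp2r // expnMn leq_mul2r cn orbT.
Qed.

(** * Primality of 2n - P *)

(** A composite 2n - P would share its least prime factor with 2n - p for the
    prime p supplied by the first hypothesis. *)
Lemma prime_double_subn (n P : nat) :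
  (forall q : nat, prime q -> coprime q (2 * n) -> q ^ 2 <= 2 * n ->
     exists p : nat, [/\ prime p, odd p, p < n, p <> P & p = 2 * n %[mod q]]) ->
  prime P -> odd P -> P < n -> coprime P n ->
  (forall p : nat, prime p -> odd p -> p < n -> p <> P ->
     coprime (2 * n - P) (2 * n - p)) ->
  prime (2 * n - P).
Proof.
move=> small_p P_prime oddP Pn co_Pn co_diff.
have P2n : P <= 2 * n by rewrite (leq_trans (ltnW Pn)) // leq_pmull.
have n_lt : n < 2 * n - P by rewrite ltn_subRL mul2n -addnn ltn_add2r.
set D := 2 * n - P in co_diff n_lt *.
have D_gt1 : 1 < D by rewrite (leq_trans _ n_lt) // ltnS (leq_ltn_trans _ Pn).
have oddD : odd D by rewrite oddB // oddM oddP.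
have q_prime := pdiv_prime D_gt1; have qD := pdiv_dvd D.
apply: ltn_pdiv2_prime; first exact: ltnW.
rewrite ltnNge; apply/negP => q2D.
have q2 : pdiv D ^ 2 <= 2 * n by rewrite (leq_trans q2D) ?leq_subr.
have q_odd : odd (pdiv D) by exact: dvdn_odd qD oddD.
have co_q : coprime (pdiv D) (2 * n).
  rewrite coprimeMr coprimen2 q_odd /= prime_coprime //.
  apply/negP => qn; have qP : pdiv D %| P.
    by rewrite -(dvdn_subr P2n) // dvdn_mull.
  by have := prime_gt1 q_prime; rewrite ltnNge dvdn_leq // -(eqP co_Pn) dvdn_gcd qP.
have [p [p_prime p_odd pn pP p_mod]] := small_p _ q_prime co_q q2.
have q_p : pdiv D %| 2 * n - p.
  by rewrite -eqn_mod_dvd ?p_mod // (leq_trans (ltnW pn)) // leq_pmull.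
have := prime_gt1 q_prime.
by rewrite ltnNge dvdn_leq // -(eqP (co_diff p p_prime p_odd pn pP)) dvdn_gcd qD.
Qed.

Local Open Scope ring_scope.

Theorem theorem1 (R : realType)
  (conj1 : forall eps : R, 0 < eps -> eps < 1 / 2 ->
     exists C1 : R, 0 < C1 /\
       forall k : nat, (1 < k)%N -> C1 < k%:R ->
         (max_least_prime R k < (k%:R `^ (2 - eps))%:E)%E)
  (conj2 : forall n : nat, (6 < n)%N ->
     let p := nth 0%N (odd_primes_below n) in
     let k := size (odd_primes_below n) in
     exists r : nat, [/\ (r < k)%N,
       coprime (p r) n &
       forall i : nat, (i < k)%N -> i <> r ->
         coprime (2 * n - p r)%N (2 * n - p i)%N]) :
  exists N : nat, forall m : nat, (N <= m)%N -> ~~ odd m ->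
    exists p q : nat, [/\ prime p, prime q, p <> q & m = (p + q)%N].
Proof.
have [C hC] := small_prime_in_class conj1.
pose c := (32 + (4 * C ^ C) ^ 2)%N.
exists (2 * (c ^ 7 + 7))%N => m m_ge m_even.
have def_m : m = (2 * m./2)%N by rewrite mul2n even_halfK.
move: (m./2) def_m => n def_m; rewrite {m m_even}def_m in m_ge *.
rewrite leq_mul2l /= in m_ge.
have c7n : (c ^ 7 <= n)%N := leq_trans (leq_addr _ _) m_ge.
have n_gt6 : (6 < n)%N := leq_trans (leq_addl _ _) m_ge.
have mem_odd p :
    (p \in odd_primes_below n) = [&& prime p, odd p & (p < n)%N].
  by rewrite mem_filter mem_iota -andbA.
have [r [r_lt co_rn co_r]] := conj2 n n_gt6.
set P := nth 0%N _ r in co_rn co_r.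
have /and3P[P_prime P_odd Pn] : [&& prime P, odd P & (P < n)%N].
  by rewrite -mem_odd mem_nth.
have P2n : (P <= 2 * n)%N by rewrite (leq_trans (ltnW Pn)) // leq_pmull.
exists P, (2 * n - P)%N; split=> //.
- apply: prime_double_subn => // [q q_prime co_q q2|p p_prime p_odd pn pP].
    have [a [a_gt0 Ca ka]] := modulus_size C (prime_gt1 q_prime)
                                (leq_ltn_trans (leq0n 6) n_gt6) q2.
    have qa_odd : odd (q ^ a).
      by move: co_q; rewrite oddX coprimeMr coprimen2 => /andP[-> _]; rewrite orbT.
    have co_qa : coprime (q ^ a) (2 * n) by rewrite coprimeXl.
    have [p [p_prime p_odd pP p_mod p_lt]] :=
      prime_in_avoiding_class hC P_odd qa_odd co_qa Ca.
    exists p; split=> //; first exact: ltn_of_powers p_lt ka c7n.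
    have q_qa : (q %| q ^ a)%N by exact: dvdn_exp.
    by rewrite -(modn_dvdm p q_qa) p_mod modn_dvdm.
  have /(nthP 0%N)[i i_lt def_p] : p \in odd_primes_below n.
    by rewrite mem_odd p_prime p_odd.
  by rewrite -def_p; apply: co_r => // ir; apply: pP; rewrite -def_p ir.
- move=> P_eq; have := subnK P2n; rewrite -P_eq addnn -mul2n => /eqP.
  by rewrite eqn_pmul2l // => /eqP nP; rewrite nP ltnn in Pn.
- by rewrite subnKC.
Qed.
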